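(* Let $R$ be a ring. Then: 1. ${}'Q_l(R)$ is a left Artinian ring if and only if ${}'Q_{l,\mathrm{cl}}(R)$ is a left Artinian ring. If one of the equivalent conditions holds then ${}'S_l(R)={}'\mathcal{C}_R$ and ${}'Q_l(R)={}'Q_{l,\mathrm{cl}}(R)$. 2. ${}'Q_l(R)$ is a semisimple Artinian ring if and only if ${}'Q_{l,\mathrm{cl}}(R)$ is a semisimple Artinian ring. If one of the equivalent conditions holds then ${}'S_l(R)={}'\mathcal{C}_R$ and ${}'Q_l(R)={}'Q_{l,\mathrm{cl}}(R)$.
   Context: Rings are associative with $1$. For a nonempty subset $S$ of a ring $R$, $\mathrm{ass}_R(S):=\{r\in R\mid sr=0\text{ for some }s\in S\}$. ${}'\mathcal{C}_R$ is the set of left regular elements of $R$: those $r\in R$ such that $xr=0$ ($x\in R$) implies $x=0$. A multiplicative set is a subset $S$ with $1\in S$, $SS\subseteq S$, $0\notin S$. It is a left Ore set if $Sr\cap Rs\neq\emptyset$ for all $r\in R$, $s\in S$. It is a left denominator set if it is left Ore and $rs=0$ with $r\in R$, $s\in S$ implies $r\in\mathrm{ass}_R(S)$; then the left localization $S^{-1}R$ exists. Among the left denominator sets of $R$ contained in ${}'\mathcal{C}_R$ there is a largest one with respect to inclusion, denoted ${}'S_l(R)$; ${}'Q_l(R):={}'S_l(R)^{-1}R$ is the left regular left quotient ring of $R$. ${}'Q_{l,\mathrm{cl}}(R):={}'\mathcal{C}_R^{-1}R$ is the classical left regular left quotient ring; it exists exactly when ${}'\mathcal{C}_R$ is a left denominator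 set, and an assertion that it has a property includes the assertion that it exists. *)

(* Defs.v *)
From HB Require Import structures.
From mathcomp Require Import all_boot all_algebra.
From mathcomp Require Import boolp classical_sets.

Set Implicit Arguments.
Unset Strict Implicit.
Unset Printing Implicit Defensive.

Import GRing.Theory.
Local Open Scope classical_set_scope.
Local Open Scope quotient_scope.
Local Open Scope ring_scope.

Section Ore_sets.
Variable R : nzRingType.
Implicit Types (S : set R).

(* The library's [GRing.lreg r] means that left multiplication by [r] is
   injective; the left regular elements here are those for which right
   multiplication [x |-> x * r] is injective. *)
Definition left_regular : set R := [set r | forall x, x * r = 0 -> x = 0].

Definition ass S : set R := [set r | exists s, S s /\ s * r = 0].

Definition multiplicative_set S : Prop :=
  [/\ S 1, forall s t, S s -> S t -> S (s * t) & ~ S 0].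

Definition left_ore_set S : Prop :=
  multiplicative_set S /\
  forall r s, S s -> exists s' r', S s' /\ s' * r = r' * s.

Definition left_denominator_set S : Prop :=
  left_ore_set S /\ forall r s, S s -> r * s = 0 -> ass S r.

End Ore_sets.

Record left_den (R : nzRingType) := LeftDen {
  left_den_set :> R -> Prop;
  left_denP : left_denominator_set left_den_set
}.

(* The left localization: formal fractions (s, r), read as s^-1 r, modulo
   (s1, r1) ~ (s2, r2) iff a s1 = b s2 \in S and a r1 = b r2 for some a, b. *)
Section Fractions.
Variables (R : nzRingType) (S : left_den R).
Implicit Types (r s t a b c : R).

Definition fraction := {x : R * R | `[< S x.1 >]}.

Definition fraction_eq (x y : fraction) : bool :=
  `[< exists a b, [/\ S (a * (val x).1), a * (val x).1 = b * (val y).1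
                    & a * (val x).2 = b * (val y).2] >].

Lemma den1 : S 1.
Proof. by case: (left_denP S) => [[[]]]. Qed.

Lemma denM s t : S s -> S t -> S (s * t).
Proof. by case: (left_denP S) => [[[_ h _] _] _]; apply: h. Qed.

Lemma den0 : ~ S 0.
Proof. by case: (left_denP S) => [[[]]]. Qed.

Lemma den_ore r s : S s -> exists t a, S t /\ t * r = a * s.
Proof. by case: (left_denP S) => [[_ h] _]; apply: h. Qed.

Lemma den_cancel a b s : S s -> a * s = b * s ->
  exists u, S u /\ u * a = u * b.
Proof.
case: (left_denP S) => [_ h] Ss e.
have [|u [Su ue]] := h (a - b) s Ss; first by rewrite mulrBl e subrr.
by exists u; split=> //; apply/eqP; rewrite -subr_eq0 -mulrBr ue.
Qed.

Lemma fractionP (x : fraction) : S (val x).1.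
Proof. exact/asboolP/(valP x). Qed.

Lemma fraction_eq_refl : reflexive fraction_eq.
Proof.
move=> x; apply/asboolP; exists 1, 1; split=> //.
by rewrite mul1r; apply: fractionP.
Qed.

Lemma fraction_eq_sym : symmetric fraction_eq.
Proof.
suff h x y : fraction_eq x y -> fraction_eq y x by move=> x y; apply/idP/idP; apply: h.
move=> /asboolP[a [b [Sa e f]]]; apply/asboolP; exists b, a.
by split; rewrite -?e.
Qed.

Lemma fraction_eq_trans : transitive fraction_eq.
Proof.
move=> [[s2 r2] h2] [[s1 r1] h1] [[s3 r3] h3] /asboolP[a [b [/= Sa e f]]].
move=> /asboolP[c [d [/= Sc g h]]]; apply/asboolP => /=.
have [t [w [St k]]] := den_ore (b * s2) Sc.
have [|u [Su uE]] := @den_cancel (t * b) (w * c) s2 (fractionP (exist _ (s2, r2) h2)).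
  by rewrite -!mulrA.
exists (u * t * a), (u * w * d); split.
- by rewrite -mulrA; apply: denM => //; apply: denM.
- by rewrite -!mulrA e -g !mulrA -(mulrA u) uE !mulrA.
- by rewrite -!mulrA f -h !mulrA -(mulrA u) uE !mulrA.
Qed.

Canonical fraction_equiv :=
  EquivRel fraction_eq fraction_eq_refl fraction_eq_sym fraction_eq_trans.

Definition left_loc := {eq_quot fraction_equiv}.

HB.instance Definition _ := Choice.on left_loc.

Fact fraction01 : `[< S (1 : R, 0 : R).1 >].
Proof. exact/asboolP/den1. Qed.

(* [lfrac s r] is s^-1 r when s \in S (and a junk value otherwise). *)
Definition lfrac s r : left_loc :=
  \pi_left_loc (insubd (exist _ (1, 0) fraction01 : fraction) (s, r)).

(* Some pair (t, a) such that t \in S and t r = a s, given s \in S. *)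
Definition ore_pair r s : R * R :=
  xget (0, 0) [set p | S p.1 /\ p.1 * r = p.2 * s].

(* s1^-1 r1 + s2^-1 r2 = (t s1)^-1 (t r1 + a r2), where t s1 = a s2. *)
Definition loc_add (q1 q2 : left_loc) : left_loc :=
  let x := val (repr q1) in let y := val (repr q2) in
  let p := ore_pair x.1 y.1 in
  lfrac (p.1 * x.1) (p.1 * x.2 + p.2 * y.2).

Definition loc_opp (q : left_loc) : left_loc :=
  let x := val (repr q) in lfrac x.1 (- x.2).

(* (s1^-1 r1) (s2^-1 r2) = (t s1)^-1 (a r2), where t r1 = a s2. *)
Definition loc_mul (q1 q2 : left_loc) : left_loc :=
  let x := val (repr q1) in let y := val (repr q2) in
  let p := ore_pair x.2 y.1 in
  lfrac (p.1 * x.1) (p.2 * y.2).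

Definition loc_act r (q : left_loc) : left_loc :=
  let y := val (repr q) in let p := ore_pair r y.1 in lfrac p.1 (p.2 * y.2).

Lemma ore_pairP r s : S s ->
  S (ore_pair r s).1 /\ (ore_pair r s).1 * r = (ore_pair r s).2 * s.
Proof.
move=> Ss; have [t [a h]] := den_ore r Ss.
have := @xgetPex _ (0, 0) [set p : R * R | S p.1 /\ p.1 * r = p.2 * s].
by apply; exists (t, a).
Qed.

Lemma val_frac s r : S s ->
  val (insubd (exist _ (1, 0) fraction01 : fraction) (s, r)) = (s, r).
Proof. by move=> Ss; rewrite insubdK //; apply/asboolP. Qed.

Lemma lfrac_eqP s r s' r' : S s -> S s' ->
  (lfrac s r = lfrac s' r' <->
   exists a b, [/\ S (a * s), a * s = b * s' & a * r = b * r']).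
Proof.
move=> Ss Ss'; split.
  by move=> /eqmodP/asboolP; rewrite !val_frac.
by move=> h; apply/eqmodP/asboolP; rewrite !val_frac.
Qed.

Lemma lfrac_repr (q : left_loc) :
  q = lfrac (val (repr q)).1 (val (repr q)).2.
Proof.
rewrite -{1}[q]reprK; congr (\pi _); apply: val_inj.
by rewrite val_frac; [case: (val _) | apply: fractionP].
Qed.

Lemma lfrac_ex (q : left_loc) : exists s r, S s /\ q = lfrac s r.
Proof.
exists (val (repr q)).1, (val (repr q)).2.
by split; [apply: fractionP | apply: lfrac_repr].
Qed.

Lemma lfrac_scale a s r : S s -> S (a * s) -> lfrac (a * s) (a * r) = lfrac s r.
Proof.
by move=> Ss Sas; apply/lfrac_eqP => //; exists 1, a; split; rewrite ?mul1r.
Qed.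

Lemma lfrac_core s x s' x' y y' : S s -> S s' -> lfrac s x = lfrac s' x' ->
  y * s = y' * s' -> exists u, S u /\ u * y * x = u * y' * x'.
Proof.
move=> Ss Ss' /lfrac_eqP -/(_ Ss Ss') [b [c [Sb e f]]] g.
have [u [w [Su k]]] := den_ore (y * s) Sb.
have [v [Sv vE]] := @den_cancel (u * y) (w * b) s Ss ltac:(by rewrite -!mulrA).
have [|v' [Sv' vE']] := @den_cancel (v * u * y') (v * w * c) s' Ss'.
  by rewrite -!mulrA -e -g k.
exists (v' * v * u); split; first by apply: denM => //; apply: denM.
have -> : v' * v * u * y * x = v' * (v * (u * y)) * x by rewrite !mulrA.
rewrite vE.
have -> : v' * (v * (w * b)) * x = v' * v * w * (b * x) by rewrite !mulrA.
have -> : v' * v * u * y' * x' = v' * (v * u * y') * x' by rewrite !mulrA.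
by rewrite f vE' !mulrA.
Qed.

Lemma lfrac_common_den s s' r r' : S s -> S s' -> exists t x x',
  [/\ S t, lfrac s r = lfrac t x & lfrac s' r' = lfrac t x'].
Proof.
move=> Ss Ss'; have [t [a [St e]]] := den_ore s Ss'.
have Sts : S (t * s) by apply: denM.
exists (t * s), (t * r), (a * r'); split=> //; first by rewrite lfrac_scale.
by rewrite e lfrac_scale -?e.
Qed.

Lemma lfrac_ex2 q q' : exists s r r', [/\ S s, q = lfrac s r & q' = lfrac s r'].
Proof.
have [s [r [Ss ->]]] := lfrac_ex q; have [s' [r' [Ss' ->]]] := lfrac_ex q'.
exact: lfrac_common_den.
Qed.

Lemma lfrac_ex3 q q' q'' : exists s r r' r'',
  [/\ S s, q = lfrac s r, q' = lfrac s r' & q'' = lfrac s r''].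
Proof.
have [s [r [r' [Ss -> ->]]]] := lfrac_ex2 q q'.
have [s' [x [Ss' ->]]] := lfrac_ex q''.
have [t [a [St e]]] := den_ore s Ss'.
have Sts : S (t * s) by apply: denM.
exists (t * s), (t * r), (t * r'), (a * x); split=> //; rewrite ?lfrac_scale //.
by rewrite e lfrac_scale -?e.
Qed.

Lemma loc_addE s r r' : S s ->
  loc_add (lfrac s r) (lfrac s r') = lfrac s (r + r').
Proof.
move=> Ss; rewrite /loc_add.
have Eq1 := lfrac_repr (lfrac s r); have Eq2 := lfrac_repr (lfrac s r').
have S1 := fractionP (repr (lfrac s r)); have S2 := fractionP (repr (lfrac s r')).
move: Eq1 Eq2 S1 S2; set x1 := val _; set x2 := val _.
case: x1 x2 => [s1 r1] [s2 r2] /= Eq1 Eq2 S1 S2.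
have [] := ore_pairP s1 S2; case: (ore_pair _ _) => c d /= Sc cd.
have SD : S (c * s1) by apply: denM.
have F1 : lfrac s r = lfrac (c * s1) (c * r1) by rewrite Eq1 lfrac_scale.
have F2 : lfrac s r' = lfrac (c * s1) (d * r2) by rewrite Eq2 cd lfrac_scale -?cd.
have [e [f [Se ef]]] := den_ore (c * s1) Ss.
have [t [St tE]] := lfrac_core Ss SD F1 (esym ef).
have [t' [St' tE']] := lfrac_core Ss SD F2 (esym ef).
have [m [n [Sm mn]]] := den_ore t St'.
apply/esym/lfrac_eqP => //; exists (m * t * f), (m * t * e); split.
- by rewrite -mulrA -ef; apply: denM; apply: denM.
- by rewrite -!mulrA ef !mulrA.
- rewrite !mulrDr; congr (_ + _).
    by rewrite -!mulrA; congr (m * _); rewrite !mulrA -!(mulrA t) !mulrA tE !mulrA.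
  by rewrite mn -!mulrA; congr (n * _); rewrite !mulrA tE' !mulrA.
Qed.

Lemma loc_oppE s r : S s -> loc_opp (lfrac s r) = lfrac s (- r).
Proof.
move=> Ss; rewrite /loc_opp.
have := lfrac_repr (lfrac s r); have S1 := fractionP (repr (lfrac s r)).
move: S1; case: (val _) => s1 r1 /= S1 /lfrac_eqP -/(_ Ss S1) [a [b [Sa e f]]].
apply/esym/lfrac_eqP => //; exists a, b; split=> //.
by rewrite !mulrN f.
Qed.

Lemma lfrac0 s : S s -> lfrac s 0 = lfrac 1 0.
Proof.
move=> Ss; rewrite -(@lfrac_scale s 1 0) ?mulr1 ?mulr0 //; exact: den1.
Qed.

Lemma loc_addA : associative loc_add.
Proof.
move=> q q' q''; have [s [r [r' [r'' [Ss -> -> ->]]]]] := lfrac_ex3 q q' q''.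
by rewrite !loc_addE // addrA.
Qed.

Lemma loc_addC : commutative loc_add.
Proof.
move=> q q'; have [s [r [r' [Ss -> ->]]]] := lfrac_ex2 q q'.
by rewrite !loc_addE // addrC.
Qed.

Lemma loc_add0 : left_id (lfrac 1 0) loc_add.
Proof.
move=> q; have [s [r [Ss ->]]] := lfrac_ex q.
by rewrite -(lfrac0 Ss) loc_addE // add0r.
Qed.

Lemma loc_addN : left_inverse (lfrac 1 0) loc_opp loc_add.
Proof.
move=> q; have [s [r [Ss ->]]] := lfrac_ex q.
by rewrite loc_oppE // loc_addE // addNr lfrac0.
Qed.

HB.instance Definition _ :=
  GRing.isZmodule.Build left_loc loc_addA loc_addC loc_add0 loc_addN.

Lemma lfracD s r r' : S s -> lfrac s (r + r') = lfrac s r + lfrac s r'.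
Proof. by move=> Ss; rewrite [RHS]loc_addE. Qed.

Lemma loc_actE r s t a x : S s -> S t -> t * r = a * s ->
  loc_act r (lfrac s x) = lfrac t (a * x).
Proof.
move=> Ss St e; rewrite /loc_act.
have := lfrac_repr (lfrac s x); have S1 := fractionP (repr (lfrac s x)).
move: S1; case: (val _) => s2 r2 /= S2 Eq.
have [] := ore_pairP r S2; case: (ore_pair _ _) => p1 p2 /= Sp p12.
have [m [n [Sm mn]]] := den_ore t Sp.
have Smt : S (m * t) by apply: denM.
have [|u [Su uE]] := @lfrac_core _ _ _ _ (m * a) (n * p2) Ss S2 Eq.
  by rewrite -!mulrA -e -p12 !mulrA mn.
apply/esym/lfrac_eqP => //; exists (u * m), (u * n); split.
- by rewrite -mulrA; apply: denM.
- by rewrite -!mulrA mn.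
- by rewrite !mulrA in uE *.
Qed.

Lemma loc_actDr r q q' : loc_act r (q + q') = loc_act r q + loc_act r q'.
Proof.
have [s [x [x' [Ss -> ->]]]] := lfrac_ex2 q q'.
have [t [a [St e]]] := den_ore r Ss.
by rewrite -lfracD // !(loc_actE _ Ss St e) mulrDr lfracD.
Qed.

Lemma loc_actDl r r' q : loc_act (r + r') q = loc_act r q + loc_act r' q.
Proof.
have [s [x [Ss ->]]] := lfrac_ex q.
have [t [a [St e]]] := den_ore r Ss; have [t' [a' [St' e']]] := den_ore r' Ss.
have [m [n [Sm mn]]] := den_ore t St'.
have ST : S (m * t) by apply: denM.
have E1 : m * t * r = m * a * s by rewrite -!mulrA e.
have E2 : m * t * r' = n * a' * s by rewrite mn -!mulrA e'.
have E3 : m * t * (r + r') = (m * a + n * a') * s.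
  by rewrite mulrDr E1 E2 mulrDl.
by rewrite (loc_actE _ Ss ST E1) (loc_actE _ Ss ST E2) (loc_actE _ Ss ST E3)
           mulrDl lfracD.
Qed.

Lemma loc_actM r r' q : loc_act (r * r') q = loc_act r (loc_act r' q).
Proof.
have [s [x [Ss ->]]] := lfrac_ex q.
have [t [a [St e]]] := den_ore r' Ss; have [t' [a' [St' e']]] := den_ore r St.
rewrite (loc_actE _ Ss St e) (loc_actE _ St St' e').
have E : t' * (r * r') = a' * a * s by rewrite mulrA e' -!mulrA e.
by rewrite (loc_actE _ Ss St' E) mulrA.
Qed.

Lemma loc_act1 q : loc_act 1 q = q.
Proof.
have [s [x [Ss ->]]] := lfrac_ex q.
have E : s * 1 = 1 * s by rewrite mulr1 mul1r.
by rewrite (loc_actE _ Ss Ss E) mul1r.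
Qed.

Lemma loc_act_inj s : S s -> injective (loc_act s).
Proof.
move=> Ss q q'; have [D [x [x' [SD -> ->]]]] := lfrac_ex2 q q'.
have [t [a [St e]]] := den_ore s SD.
rewrite !(loc_actE _ SD St e) => h.
have [u [Su uE]] := lfrac_core St St h (erefl (1 * t)).
have SuaD : S (u * a * D) by rewrite -mulrA -e; apply: (denM Su); apply: denM.
rewrite -(@lfrac_scale (u * a) D x) // -(@lfrac_scale (u * a) D x') //.
by move: uE; rewrite !mulr1 !mulrA => ->.
Qed.

Lemma loc_act_frac s t x : S s -> S t -> loc_act s (lfrac (t * s) x) = lfrac t x.
Proof.
move=> Ss St; have E : t * s = 1 * (t * s) by rewrite mul1r.
by rewrite (loc_actE _ (denM St Ss) St E) mul1r.
Qed.

Lemma loc_act_num s x : S s -> loc_act s (lfrac s x) = lfrac 1 x.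
Proof. by move=> Ss; rewrite -{2}[s]mul1r loc_act_frac //; apply: den1. Qed.

Lemma loc_mulE s r q : S s -> loc_act s (loc_mul (lfrac s r) q) = loc_act r q.
Proof.
move=> Ss; set q1 := lfrac s r.
have S1 := fractionP (repr q1).
have Eq : lfrac s r = lfrac (val (repr q1)).1 (val (repr q1)).2.
  exact: lfrac_repr.
have H1 : loc_act (val (repr q1)).1 (loc_mul q1 q) = loc_act (val (repr q1)).2 q.
  rewrite /loc_mul loc_act_frac //.
  by case: (ore_pairP (val (repr q1)).2 (fractionP (repr q))).
move: (val (repr q1)) S1 Eq H1 => [s1 r1] /= S1.
move=> /lfrac_eqP -/(_ Ss S1) [b [c [Sb e f]]] H1.
have [q' Hq'] : exists q', loc_act s q' = loc_act r q.
  have [D [x [SD ->]]] := lfrac_ex (loc_act r q).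
  by exists (lfrac (D * s) x); rewrite loc_act_frac.
suff -> : loc_mul q1 q = q' by [].
apply: (loc_act_inj Sb); rewrite {1}e !loc_actM H1 Hq' -!loc_actM.
by rewrite f.
Qed.

Lemma loc_act_mul r q q' : loc_act r (loc_mul q q') = loc_mul (loc_act r q) q'.
Proof.
have [s [x [Ss ->]]] := lfrac_ex q; have [t [a [St e]]] := den_ore r Ss.
apply: (loc_act_inj St).
rewrite (loc_actE _ Ss St e) loc_mulE // -loc_actM e !loc_actM.
by rewrite loc_mulE.
Qed.

Lemma loc_mulA : associative loc_mul.
Proof.
move=> q1 q2 q3; have [s [x [Ss ->]]] := lfrac_ex q1.
apply: (loc_act_inj Ss).
by rewrite loc_mulE // loc_act_mul [in RHS]loc_act_mul loc_mulE // loc_act_mul.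
Qed.

Lemma lfrac1E s : S s -> lfrac s s = lfrac 1 1.
Proof.
by move=> Ss; rewrite -(@lfrac_scale s 1 1) ?mulr1 //; apply: den1.
Qed.

Lemma loc_mul1q : left_id (lfrac 1 1) loc_mul.
Proof. by move=> q; apply: (loc_act_inj den1); rewrite loc_mulE //; apply: den1. Qed.

Lemma loc_mulq1 : right_id (lfrac 1 1) loc_mul.
Proof.
move=> q; have [s [x [Ss ->]]] := lfrac_ex q.
apply: (loc_act_inj Ss); rewrite loc_mulE // loc_act_num //.
have E : 1 * x = x * 1 by rewrite mul1r mulr1.
by rewrite (loc_actE _ den1 den1 E) mulr1.
Qed.

Lemma loc_mulDl : left_distributive loc_mul +%R.
Proof.
move=> q q' p; have [s [x [x' [Ss -> ->]]]] := lfrac_ex2 q q'.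
apply: (loc_act_inj Ss).
by rewrite loc_actDr -lfracD // !loc_mulE // loc_actDl.
Qed.

Lemma loc_mulDr : right_distributive loc_mul +%R.
Proof.
move=> q p p'; have [s [x [Ss ->]]] := lfrac_ex q.
apply: (loc_act_inj Ss).
by rewrite loc_actDr !loc_mulE // loc_actDr.
Qed.

Lemma loc_one_neq0 : lfrac 1 1 != 0.
Proof.
apply/eqP => h.
have [u [Su]] := lfrac_core den1 den1 h (erefl (1 * 1)).
by rewrite !mulr1 mulr0 => u0; apply: den0; rewrite -u0.
Qed.

HB.instance Definition _ := GRing.Zmodule_isNzRing.Build left_loc
  loc_mulA loc_mul1q loc_mulq1 loc_mulDl loc_mulDr loc_one_neq0.

Definition loc_map r : left_loc := lfrac 1 r.

Lemma loc_act_map r q : loc_act r q = loc_map r * q.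
Proof.
by rewrite -[RHS]loc_act1 [loc_act 1 _]loc_mulE //; apply: den1.
Qed.

Lemma loc_map_is_zmod_morphism : zmod_morphism loc_map.
Proof.
move=> r r'; apply/eqP; rewrite eq_sym subr_eq eq_sym.
by rewrite /loc_map -lfracD ?subrK //; apply: den1.
Qed.

Lemma loc_map_is_monoid_morphism : monoid_morphism loc_map.
Proof.
split=> // r r'; rewrite -loc_act_map.
have E : 1 * r = r * 1 by rewrite mul1r mulr1.
by rewrite (loc_actE _ den1 den1 E).
Qed.

HB.instance Definition _ :=
  GRing.isZmodMorphism.Build R left_loc loc_map loc_map_is_zmod_morphism.
HB.instance Definition _ :=
  GRing.isMonoidMorphism.Build R left_loc loc_map loc_map_is_monoid_morphism.

(* The three properties characterizing S^-1 R, up to isomorphism over R. *)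
Lemma loc_map_unit s : S s ->
  lfrac s 1 * loc_map s = 1 /\ loc_map s * lfrac s 1 = 1.
Proof.
move=> Ss; rewrite -loc_act_map loc_act_num //; split=> //.
by apply: (loc_act_inj Ss); rewrite [LHS]loc_mulE // loc_act1 loc_act_map mulr1.
Qed.

Lemma lfracE s r : S s -> lfrac s r = lfrac s 1 * loc_map r.
Proof.
move=> Ss; apply: (loc_act_inj Ss).
by rewrite loc_act_num // [RHS]loc_mulE // loc_act1.
Qed.

Lemma loc_map_eq0 r : loc_map r = 0 <-> ass S r.
Proof.
split=> [h | [s [Ss e]]].
  have [u [Su uE]] := lfrac_core den1 den1 h (erefl (1 * 1)).
  by exists u; split=> //; move: uE; rewrite !mulr1 mulr0.
apply: (loc_act_inj Ss); rewrite !loc_act_map mulr0.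
by rewrite -rmorphM e rmorph0.
Qed.

End Fractions.

Section Largest.
Variable R : nzRingType.

Definition largest_left_regular_den (S : set R) : Prop :=
  [/\ left_denominator_set S, S `<=` @left_regular R
    & forall T, left_denominator_set T -> T `<=` @left_regular R -> T `<=` S].

(* The submonoid generated by all left denominator sets of left regular
   elements; it is the largest of them. *)
Inductive regular_den_span : set R :=
| Span_one : regular_den_span 1
| Span_mul (T : set R) s t : left_denominator_set T ->
    T `<=` @left_regular R -> T s -> regular_den_span t ->
    regular_den_span (s * t).

Lemma largest_left_regular_den_ex : exists S, largest_left_regular_den S.
Proof.
have spanM s t : regular_den_span s -> regular_den_span t ->
    regular_den_span (s * t).
  elim=> [|T u v dT rT Tu _ IH] st; first by rewrite mul1r.
  by rewrite -mulrA; apply: (Span_mul dT rT Tu); apply: IH.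
have sub T : left_denominator_set T -> T `<=` @left_regular R ->
    T `<=` regular_den_span.
  move=> dT rT s Ts; rewrite -[s]mulr1.
  exact: (Span_mul dT rT Ts Span_one).
have reg : regular_den_span `<=` @left_regular R.
  move=> s; elim=> [x|T u v dT rT Tu _ IH x]; first by rewrite mulr1.
  by rewrite mulrA => /IH/(rT _ Tu).
exists regular_den_span; split=> //; split; last first.
  by move=> r s /reg h /h ->; exists 1; rewrite mulr0; split=> //; apply: Span_one.
split; first split=> //.
- exact: Span_one.
- by move=> /reg /(_ 1) h; have := oner_neq0 R; rewrite h ?eqxx // mulr0.
move=> r s h; elim: h r => [|T u v dT rT Tu _ IH] r.
  by exists 1, r; rewrite mulr1 mul1r; split=> //; apply: Span_one.
have [s1 [r1 [S1 e1]]] := IH r.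
have [[_ /(_ r1 u Tu) [s2 [r2 [S2 e2]]]] _] := dT.
exists (s2 * s1), r2; split; first by apply: spanM => //; apply: (sub T).
by rewrite -mulrA e1 !mulrA e2.
Qed.

Definition Sl_set : set R := sval (cid largest_left_regular_den_ex).

Lemma Sl_largest : largest_left_regular_den Sl_set.
Proof. exact: svalP (cid largest_left_regular_den_ex). Qed.

Lemma Sl_den : left_denominator_set Sl_set.
Proof. by case: Sl_largest. Qed.

End Largest.

Arguments left_regular : clear implicits.
Arguments Sl_set : clear implicits.

Definition Sl (R : nzRingType) : left_den R := LeftDen (Sl_den R).

Definition Ql (R : nzRingType) : nzRingType := left_loc (Sl R).

(* [h] is the condition under which the classical ring exists, and [Qlcl_is]
   asserts both its existence and that it has the property [P]. *)
Definition Qlcl (R : nzRingType)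
    (h : left_denominator_set (left_regular R)) : nzRingType :=
  left_loc (LeftDen h).

Definition Qlcl_is (R : nzRingType) (P : nzRingType -> Prop) : Prop :=
  exists h : left_denominator_set (left_regular R), P (Qlcl h).

(* Equality of localizations of R: the ring isomorphism over R. *)
Definition loc_iso (R : nzRingType) (S T : left_den R) : Prop :=
  exists f : {rmorphism left_loc S -> left_loc T},
    bijective f /\ forall r : R, f (loc_map S r) = loc_map T r.

Section Chain_conditions.
Variable Q : nzRingType.

Definition left_ideal (I : set Q) : Prop :=
  [/\ I 0, forall x y, I x -> I y -> I (x + y) & forall a x, I x -> I (a * x)].

Definition left_artinian : Prop :=
  forall I : nat -> set Q, (forall n, left_ideal (I n)) ->
    (forall n, I n.+1 `<=` I n) ->
    exists n, forall m, (n <= m)%N -> I m = I n.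

Definition minimal_left_ideal (I : set Q) : Prop :=
  [/\ left_ideal I, I <> [set 0]
    & forall J, left_ideal J -> J `<=` I -> J = [set 0] \/ J = I].

(* The left regular module is the sum of its simple submodules. *)
Definition semisimple_ring : Prop :=
  forall x : Q, exists n (u : 'I_n -> Q),
    (forall i, exists I, minimal_left_ideal I /\ I (u i)) /\ x = \sum_i u i.

(* Such a ring is also right Artinian, by the Wedderburn-Artin theorem. *)
Definition semisimple_artinian : Prop := semisimple_ring /\ left_artinian.

End Chain_conditions.

(* Main.v *)
Require Import Defs.
From mathcomp Require Import all_boot all_algebra.
From mathcomp Require Import boolp classical_sets.

(** The largest left denominator set of left regular elements equals the set
    of all left regular elements as soon as the latter is a left denominator
    set, so the whole theorem reduces to one implication: if the ring of
    fractions [Ql R] is left Artinian, then the left regular elements of [R]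
    satisfy the left Ore condition.

    A left regular element [c] of [R] stays left regular in [Ql R], because the
    denominators are left regular themselves ([loc_map_left_regular]).  In a
    left Artinian ring a left regular element is a unit, since the chain of
    left ideals generated by its powers stabilizes
    ([left_artinian_left_regular_unit]).  Hence [r c^-1] makes sense in [Ql R];
    writing it as a left fraction [t^-1 a] and clearing denominators gives an
    Ore relation [t' r = a' c] in [R]
    ([left_denominator_set_left_regular]).  Once the two denominator sets
    coincide, the two localizations are the same ring, and they share the left
    Artinian and the semisimple Artinian properties. *)

Set Implicit Arguments.
Unset Strict Implicit.
Unset Printing Implicit Defensive.

Import GRing.Theory.
Local Open Scope classical_set_scope.
Local Open Scope ring_scope.

Lemma left_ideal_principal (Q : nzRingType) (c : Q) :
  left_ideal [set y | exists q, y = q * c].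
Proof.
split; first by exists 0; rewrite mul0r.
- by move=> _ _ [q ->] [q' ->]; exists (q + q'); rewrite mulrDl.
- by move=> a _ [q ->]; exists (a * q); rewrite mulrA.
Qed.

Lemma left_regular_cancel (Q : nzRingType) (c x y : Q) :
  left_regular Q c -> x * c = y * c -> x = y.
Proof.
by move=> creg /eqP; rewrite -subr_eq0 -mulrBl => /eqP /creg /eqP; rewrite subr_eq0 => /eqP.
Qed.

Lemma left_regularX (Q : nzRingType) (c : Q) n :
  left_regular Q c -> left_regular Q (c ^+ n).
Proof.
move=> creg; elim: n => [|n IHn] x; first by rewrite expr0 mulr1.
by rewrite exprSr mulrA => /creg /IHn.
Qed.

(** If [Q c^n = Q c^(n+1)] then [c^n = q c^(n+1)], and cancelling [c^n] on the
    right gives [q c = 1]; the left inverse is two-sided because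
    [(c q) c = c (q c) = c] and [c] cancels as well. *)
Lemma left_artinian_left_regular_unit (Q : nzRingType) (c : Q) :
  left_artinian Q -> left_regular Q c -> exists q, q * c = 1 /\ c * q = 1.
Proof.
move=> artQ creg.
have [| n c_stab] := artQ _ (fun n => left_ideal_principal (c ^+ n)).
  by move=> n _ [q ->]; exists (q * c); rewrite exprS mulrA.
have : [set y | exists q, y = q * c ^+ n] (c ^+ n) by exists 1; rewrite mul1r.
rewrite -(c_stab n.+1) // => -[q Eq].
have qc1 : q * c = 1.
  apply: (left_regular_cancel (@left_regularX _ _ n creg)).
  by rewrite mul1r -mulrA -exprS -Eq.
exists q; split=> //.
by apply: (left_regular_cancel creg); rewrite mul1r -mulrA qc1 mulr1.
Qed.

(** If [s^-1 r] kills [c] on the left then [u r c = 0] for some denominator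
    [u], so [u r = 0], which says that [r] vanishes in the localization. *)
Lemma loc_map_left_regular (R : nzRingType) (S : left_den R) (c : R) :
  left_regular R c -> left_regular (left_loc S) (loc_map S c).
Proof.
move=> creg q; have [s [r [Ss ->]]] := lfrac_ex q.
rewrite (lfracE r Ss) -mulrA -rmorphM => /(congr1 (fun y => loc_map S s * y)).
rewrite mulrA mulr0; have [_ ->] := loc_map_unit Ss.
rewrite mul1r => /loc_map_eq0 [u [Su]]; rewrite mulrA => /creg ur0.
have /loc_map_eq0 -> : ass S r by exists u.
by rewrite mulr0.
Qed.

Lemma left_denominator_set_left_regular (R : nzRingType) (S : left_den R) :
  left_den_set S `<=` left_regular R -> left_artinian (left_loc S) ->
  left_denominator_set (left_regular R).
Proof.
move=> Sreg artS; split; last first.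
  by move=> r s sreg /sreg ->; exists 1; split; [move=> x; rewrite mulr1 | rewrite mulr0].
split; first split.
- by move=> x; rewrite mulr1.
- by move=> s t sreg treg x; rewrite mulrA => /treg /sreg.
- by move=> /(_ 1 (mulr0 1)) /eqP; rewrite oner_eq0.
move=> r c creg.
have [q [qc1 _]] := left_artinian_left_regular_unit artS
                      (loc_map_left_regular (S := S) creg).
have [t [a [St Et]]] := lfrac_ex (loc_map S r * q).
have Etr : loc_map S (t * r - a * c) = 0.
  have [_ tV] := loc_map_unit St.
  have -> : loc_map S (t * r - a * c)
            = loc_map S t * loc_map S r - loc_map S a * loc_map S c.
    by rewrite rmorphB !rmorphM.
  (* Insert [q c = 1] to the right of [r] and replace [r q] by [t^-1 a]. *)
  rewrite -[loc_map S r]mulr1 -qc1 (mulrA (loc_map S r)) Et (lfracE a St).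
  by rewrite !mulrA tV mul1r subrr.
have /loc_map_eq0 [u [Su]] := Etr.
rewrite mulrBr !mulrA => /eqP; rewrite subr_eq0 => /eqP Eu.
by exists (u * t), (u * a); split=> //; apply/Sreg/denM.
Qed.

Lemma left_den_inj (R : nzRingType) (S T : left_den R) :
  left_den_set S = left_den_set T -> S = T.
Proof.
case: S T => S hS [T hT] /= ST; move: hS; rewrite ST => hS.
by congr LeftDen; apply: Prop_irrelevance.
Qed.

Lemma Sl_eq (R : nzRingType) (h : left_denominator_set (left_regular R)) :
  Sl R = LeftDen h.
Proof.
apply: left_den_inj; have [_ Sreg Smax] := Sl_largest R.
by apply/seteqP; split=> //; apply: Smax.
Qed.

Lemma loc_iso_refl (R : nzRingType) (S : left_den R) : loc_iso S S.
Proof. by exists idfun; split=> //; exists idfun. Qed.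

(** The two parts of the theorem are the instances of this equivalence for
    properties [P] that are at least as strong as being left Artinian. *)
Lemma Ql_Qlcl_equiv (R : nzRingType) (P : nzRingType -> Prop) :
  (forall Q, P Q -> left_artinian Q) ->
  (P (Ql R) <-> Qlcl_is R P) /\
  (P (Ql R) \/ Qlcl_is R P ->
     Sl_set R = left_regular R /\
     exists h : left_denominator_set (left_regular R),
       loc_iso (Sl R) (LeftDen h)).
Proof.
move=> P_art.
have Ql_den : P (Ql R) -> left_denominator_set (left_regular R).
  have [_ Sreg _] := Sl_largest R.
  by move=> /P_art; apply: left_denominator_set_left_regular.
have QlE (h : left_denominator_set (left_regular R)) : Ql R = Qlcl h.
  by rewrite /Ql (Sl_eq h).
have den_concl : left_denominator_set (left_regular R) ->
    Sl_set R = left_regular R /\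
    exists h : left_denominator_set (left_regular R),
      loc_iso (Sl R) (LeftDen h).
  move=> h; split; first by have := congr1 (@left_den_set R) (Sl_eq h).
  by exists h; rewrite (Sl_eq h); apply: loc_iso_refl.
split; last by case=> [/Ql_den | [h _]]; apply: den_concl.
by split=> [PQ | [h]]; [exists (Ql_den PQ) |]; rewrite -QlE.
Qed.

Theorem theorem4p3 (R : nzRingType) :
  ((left_artinian (Ql R) <-> Qlcl_is R left_artinian) /\
   (left_artinian (Ql R) \/ Qlcl_is R left_artinian ->
      Sl_set R = left_regular R /\
      exists h : left_denominator_set (left_regular R),
        loc_iso (Sl R) (LeftDen h)))
  /\
  ((semisimple_artinian (Ql R) <-> Qlcl_is R semisimple_artinian) /\
   (semisimple_artinian (Ql R) \/ Qlcl_is R semisimple_artinian ->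
      Sl_set R = left_regular R /\
      exists h : left_denominator_set (left_regular R),
        loc_iso (Sl R) (LeftDen h))).
Proof.
split; first exact: Ql_Qlcl_equiv.
by apply: Ql_Qlcl_equiv => Q [].
Qed.
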